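(* Let $C$ be the extended ternary quadratic residue code of length $14$ and let $f\in\mathrm{Harm}_3$ be a harmonic function of degree $3$ that is invariant under $\mathrm{Aut}(C)$. Then there exists a constant $c_f$ such that $$w_{C,f}(x,y)=c_f\,\bigl(-312x^{8}y^{6}+468x^{7}y^{7}+312x^{6}y^{8}-624x^{5}y^{9}+156x^{3}y^{11}\bigr).$$
   Context: Extended quadratic residue code: for an odd prime $p$ and prime power $q$ which is a quadratic residue mod $p$, with $\alpha$ a primitive $p$-th root of unity over $\mathbb{F}_q$, the quadratic residue code is the cyclic code in $\mathbb{F}_q[x]/(x^p-1)$ generated by $\prod_{r\in(\mathbb{F}_p^\ast)^2}(x-\alpha^r)$; the extended code appends the coordinate $-\sum_{i=1}^p c_i$. Here $q=3$, $p=13$, $n=14$. $\mathrm{Aut}(C)$ is the group of coordinate permutations $\sigma\in S_n$ with $C^\sigma=C$. Harmonic functions: let $\Omega=\{1,\dots,n\}$, $X$ the set of subsets of $\Omega$, $X_k$ the $k$-subsets; $\mathbb{R}X$, $\mathbb{R}X_k$ the real vector spaces with bases $X$, $X_k$. For $f=\sum_{z\in X_k}f(z)z\in\mathbb{R}X_k$ define $\widetilde f(u)=\sum_{z\in X_k,\,z\subset u}f(z)$ for $u\in X$. The linear operator $\gamma$ is given by $\gamma(z)=\sum_{y\in X_{k-1},\,y\subset z}y$ for $z\in X_k$, and $\mathrm{Harm}_k=\ker(\gamma|_{\mathbb{R}X_k})$. $S_n$ acts on $\mathbb{R}X_k$ by permuting $\Omega$, and $f$ is invariant under $\mathrm{Aut}(C)$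 if $f^\sigma=f$ for all $\sigma\in\mathrm{Aut}(C)$. The harmonic weight enumerator is $w_{C,f}(x,y)=\sum_{c\in C}\widetilde f(\mathrm{supp}(c))\,x^{n-\mathrm{wt}(c)}y^{\mathrm{wt}(c)}$, where $\mathrm{supp}(c)$ is the set of nonzero coordinates and $\mathrm{wt}(c)=|\mathrm{supp}(c)|$. *)

(* Defs.v *)
From HB Require Import structures.
From mathcomp Require Import all_boot all_order all_fingroup all_algebra.
From mathcomp Require Import all_field reals.
From mathcomp.multinomials Require Import mpoly.

Set Implicit Arguments.
Unset Strict Implicit.
Unset Printing Implicit Defensive.

Import GRing.Theory.
Local Open Scope ring_scope.

Section QuadraticResidueCode.
Variables (F : finFieldType) (L : fieldType) (iota : {rmorphism F -> L}).
Variables (p : nat) (alpha : L).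

Definition nonzero_squares : {set 'F_p} := [set s ^+ 2 | s in [set~ 0]].

Definition qr_poly : {poly L} :=
  \prod_(r in nonzero_squares) ('X - (alpha ^+ r)%:P).

(* Coefficientwise preimage under iota; it is a genuine preimage, by
   [map_qr_genpoly] below, when #|F| is a quadratic residue modulo p. *)
Definition qr_genpoly : {poly F} :=
  map_poly (fun x => odflt 0 [pick a | iota a == x]) qr_poly.

(* The ideal generated by qr_genpoly in F[X]/(X^p - 1), a residue class being
   identified with the vector of coefficients of 1, X, ..., X^(p-1). *)
Definition qr_code : {set 'rV[F]_p} :=
  [set poly_rV (a * in_qpoly ('X^p - 1) qr_genpoly : {poly F})
     | a : {poly %/ ('X^p - 1 : {poly F})}].

Definition extend_word (c : 'rV[F]_p) : 'rV[F]_p.+1 :=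
  \row_i oapp (c 0) (- \sum_j c 0 j) (unlift ord_max i).

Definition ext_qr_code : {set 'rV[F]_p.+1} := extend_word @: qr_code.

Lemma map_qr_genpoly :
    prime p -> p.-primitive_root alpha -> #|F|%:R \in nonzero_squares ->
  map_poly iota qr_genpoly = qr_poly.
Proof.
move=> p_pr prim_a qr_q; pose q := #|F|.
have iota_im x : x ^+ q = x -> exists a, iota a = x.
  move=> xq; have := congr1 (map_poly iota) (finField_genPoly F).
  rewrite rmorphB /= map_polyXn map_polyX rmorph_prod /=.
  move/(congr1 (horner^~ x)); rewrite !hornerE xq subrr horner_prod.
  move/esym/eqP/prodf_eq0 => [a _].
  rewrite rmorphB /= map_polyX map_polyC !hornerE subr_eq0 => /eqP ->.
  by exists a.
suff frobP i : qr_poly`_i ^+ q = qr_poly`_i.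
  rewrite /qr_genpoly; apply/polyP => i.
  have g0 : odflt 0 [pick a | iota a == 0] = 0.
    by case: pickP => //= a; rewrite fmorph_eq0 => /eqP.
  rewrite coef_map coef_map_id0 //.
  have [a <-] := iota_im _ (frobP i).
  case: pickP => [b /eqP /= -> //|/(_ a)]; by rewrite eqxx.
have [l l_pr pcharF] := finPcharP F.
have qpchar : [pchar L].-nat q.
  rewrite /q (card_pprimeChar pcharF) pnatX; apply/orP; left.
  by rewrite pnatE // (fmorph_pchar iota).
have frobB (x y : L) : (x - y) ^+ q = x ^+ q - y ^+ q.
  by apply/(addIr (y ^+ q)); rewrite -exprDn_pchar // !subrK.
have q_gt0 : (0 < q)%N by case/andP: qpchar.
have frob_prod (s : seq 'F_p) j :
    (\prod_(r <- s) ('X - (alpha ^+ r)%:P))`_j ^+ q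
    = (\prod_(r <- s) ('X - ((alpha ^+ r) ^+ q)%:P))`_j.
  elim: s j => [|r s IHs] j.
    rewrite !big_nil coef1; case: (j == 0%N); first exact: expr1n.
    by rewrite expr0n eqn0Ngt q_gt0.
  rewrite !big_cons !mulrBl !coefB !coefXM !coefCM frobB exprMn !IHs.
  by case: (j == 0%N); rewrite ?IHs // expr0n eqn0Ngt q_gt0.
rewrite /qr_poly -!big_enum frob_prod !big_enum /=.
have q_neq0 : #|F|%:R != 0 :> 'F_p.
  by have /imsetP[s] := qr_q; rewrite !inE => s0 ->; rewrite expf_neq0.
rewrite [in RHS](reindex_inj (mulfI q_neq0)).
congr (nth 0 (polyseq _) i); apply: eq_big => [r|r _].
  have /imsetP[s] := qr_q; rewrite !inE => s0 qs.
  apply/imsetP/imsetP => [[t]|[t]]; rewrite !inE => t0 rt.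
    by exists (s * t); rewrite ?inE ?mulf_neq0 // exprMn qs rt.
  exists (t / s); first by rewrite !inE mulf_neq0 ?invr_eq0.
  by rewrite expr_div_n -rt qs mulrC mulKf // expf_neq0.
congr ('X - _%:P); rewrite -exprM; apply/eqP.
rewrite (eq_prim_root_expr prim_a); apply/eqP.
have eq_modp m m' : m%:R = m'%:R :> 'F_p -> (m = m' %[mod p])%N.
  by move/(congr1 (@nat_of_ord _)); rewrite !val_Fp_nat.
by apply: eq_modp; rewrite natrM !natr_Zp mulrC.
Qed.

End QuadraticResidueCode.

Section CodeAutomorphisms.
Variables (F : finFieldType) (n : nat).

(* The coordinate at position i moves to position s i. *)
Definition perm_word (s : 'S_n) (c : 'rV[F]_n) : 'rV[F]_n :=
  \row_i c 0 ((s^-1)%g i).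

Definition code_aut (C : {set 'rV[F]_n}) : {set 'S_n} :=
  [set s | perm_word s @: C == C].

Definition supp (c : 'rV[F]_n) : {set 'I_n} := [set i | c 0 i != 0].

Definition wt (c : 'rV[F]_n) : nat := #|supp c|.

End CodeAutomorphisms.

Section HarmonicFunctions.
Variables (R : realType) (n : nat).

(* The space with basis the set of subsets of {0, ..., n-1}. *)
Local Notation RX := {ffun {set 'I_n} -> R^o}.

Definition basis_vec (z : {set 'I_n}) : RX := [ffun u => (u == z)%:R].

Definition in_RX (k : nat) (f : RX) : Prop :=
  forall z : {set 'I_n}, #|z| != k -> f z = 0.

Definition gamma (f : RX) : RX :=
  \sum_(z : {set 'I_n})
    f z *: \sum_(y : {set 'I_n} | (#|y|.+1 == #|z|) && (y \subset z))
             basis_vec y.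

Definition Harm (k : nat) (f : RX) : Prop := in_RX k f /\ gamma f = 0.

Definition perm_fun (s : 'S_n) (f : RX) : RX :=
  \sum_(z : {set 'I_n}) f z *: basis_vec (s @: z).

Definition tilde (k : nat) (f : RX) (u : {set 'I_n}) : R :=
  \sum_(z : {set 'I_n} | (#|z| == k) && (z \subset u)) f z.

Definition harm_wt_enum (F : finFieldType) (C : {set 'rV[F]_n})
    (k : nat) (f : RX) : {mpoly R[2]} :=
  \sum_(c in C) tilde k f (supp c) *:
    ('X_ord0 ^+ (n - wt c) * 'X_ord_max ^+ wt c).

End HarmonicFunctions.

(* Main.v *)
Require Import Defs.
From HB Require Import structures.
From mathcomp Require Import all_boot all_order all_fingroup all_algebra.
From mathcomp Require Import all_field reals.
From mathcomp Require Import ring.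
From mathcomp.multinomials Require Import mpoly.

(** Harmonicity makes the values of [f] on the 3-subsets sum to zero.  Over F_3
    the polynomial X^13 - 1 is (X - 1) g1 g2, and each g_i(X) divides g_i(X^4);
    since 4 generates the squares modulo 13, the generator polynomial is g1 or
    g2, according to which of them vanishes at alpha.  For either generator, the
    weight distribution of the codewords whose support contains a given 3-subset
    takes only two values A and B, as inspection of the 3^7 codewords and the
    364 triples shows.  Exchanging the sums over codewords and triples, w_(C,f)
    is therefore a multiple of A - B. *)

Set Implicit Arguments.
Unset Strict Implicit.
Unset Printing Implicit Defensive.

Import GRing.Theory Num.Theory.
Local Open Scope ring_scope.

(** * Listing the codewords and counting weights through each triple *)

Section Computation.
Local Open Scope nat_scope.

Fixpoint add_coefs (s t : seq nat) : seq nat :=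
  match s, t with
  | x :: s', y :: t' => x + y :: add_coefs s' t'
  | [::], _ => t
  | _, [::] => s
  end.

(* Coefficients of the m g over F_3 with deg m < k, as natural numbers that are
   not reduced modulo 3. *)
Fixpoint multiples (g : seq nat) (k : nat) : seq (seq nat) :=
  if k is k'.+1 then
    [seq add_coefs [seq a * x | x <- g] (0 :: v)
       | a <- [:: 0; 1; 2], v <- multiples g k']
  else [:: nseq (size g).-1 0].

(* The sign of the appended coordinate is dropped: only its vanishing counts. *)
Definition nonzero_pattern (v : seq nat) : bitseq :=
  [seq x %% 3 != 0 | x <- rcons v (sumn v)].

Definition by_weight (bs : seq bitseq) : seq (seq bitseq) :=
  [seq [seq b <- bs | count id b == w] | w <- iota 0 15].

Definition with_bit (i : nat) (ss : seq (seq bitseq)) : seq (seq bitseq) :=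
  [seq [seq b : bitseq <- s | nth false b i] | s <- ss].

(** Entry w is the number of codewords of weight w whose support contains a given triple. The two
    lists differ exactly at weights 6, 7, 8, 9 and 11. *)
Definition profile_a : seq nat :=
  [:: 0; 0; 0; 0; 0; 0; 12; 12; 54; 88; 180; 164; 110; 0; 28].

Definition profile_b : seq nat :=
  [:: 0; 0; 0; 0; 0; 0; 8; 18; 58; 80; 180; 166; 110; 0; 28].

(** Only triples i < j < k < 14 are visited, and each filtered list is shared by the inner loops. *)
Definition two_profiles (bs : seq bitseq) : bool :=
  let s := by_weight bs in
  all (fun i => let si := with_bit i s in
    all (fun j => let sj := with_bit j si in
      all (fun k => map size (with_bit k sj) \in [:: profile_a; profile_b])
          (iota j.+1 (13 - j)))
        (iota i.+1 (13 - i)))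
      (iota 0 14).

Definition qr_coefs1 : seq nat := [:: 1; 1; 2; 0; 2; 1; 1].
Definition qr_coefs2 : seq nat := [:: 1; 0; 2; 2; 2; 0; 1].

Lemma two_profiles_qr1 :
  two_profiles (map nonzero_pattern (multiples qr_coefs1 7)).
Proof. by vm_compute. Qed.

Lemma two_profiles_qr2 :
  two_profiles (map nonzero_pattern (multiples qr_coefs2 7)).
Proof. by vm_compute. Qed.

Lemma two_profilesP (bs : seq bitseq) (i j k : nat) :
    two_profiles bs -> i < j -> j < k -> k < 14 ->
  exists2 p, p \in [:: profile_a; profile_b] &
    forall w, w < 15 ->
      count (fun b => [&& nth false b i, nth false b j, nth false b k
                        & count id b == w]) bs = nth 0 p w.
Proof.
move=> tp ij jk k14.
have j14 := ltn_trans jk k14; have i14 := ltn_trans ij j14.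
have /allP/(_ i) := tp; rewrite mem_iota leq0n add0n i14 => /(_ isT).
move/allP/(_ j); rewrite mem_iota ij addSn subnKC ?j14; last exact: i14.
move=> /(_ isT) /allP/(_ k).
rewrite mem_iota jk addSn subnKC ?k14; last exact: j14.
move=> /(_ isT) pP; eexists; first exact: pP.
move=> w w15; rewrite /with_bit /by_weight -!map_comp.
rewrite (nth_map 0) ?size_iota // nth_iota // add0n /=.
rewrite -!filter_predI size_filter.
apply: eq_count => b /=.
by case: (nth _ _ i); case: (nth _ _ j); case: (nth _ _ k).
Qed.

End Computation.

Arguments multiples : simpl never.

(** * Coefficient lists as polynomials over F_3 *)

Lemma nth_add_coefs (s t : seq nat) (i : nat) :
  nth 0%N (add_coefs s t) i = (nth 0%N s i + nth 0%N t i)%N.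
Proof.
elim: s t i => [|x s IHs] [|y t] [|i] //=; rewrite ?nth_nil ?addn0 //.
Qed.

Lemma size_add_coefs (s t : seq nat) :
  size (add_coefs s t) = maxn (size s) (size t).
Proof. by elim: s t => [|x s IHs] [|y t] //=; rewrite ?IHs ?maxnSS. Qed.

Lemma size_multiples (g v : seq nat) (k : nat) :
  (0 < size g)%N -> v \in multiples g k -> size v = ((size g).-1 + k)%N.
Proof.
move=> g0; elim: k v => [|k IHk] v.
  by rewrite inE => /eqP->; rewrite size_nseq addn0.
case/allpairsP=> [[a u] /= [_ /IHk size_u ->]].
rewrite size_add_coefs /= size_map size_u addnS.
by apply/maxn_idPr; rewrite -{1}(prednK g0) ltnS leq_addr.
Qed.

Section NatCoefs.
Variable F : comNzRingType.

Definition natpoly (v : seq nat) : {poly F} := Poly [seq n%:R | n <- v].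

Lemma coef_natpoly (v : seq nat) (i : nat) :
  (natpoly v)`_i = (nth 0%N v i)%:R.
Proof.
rewrite coef_Poly; have [iv|vi] := ltnP i (size v); first exact: nth_map.
by rewrite !nth_default ?size_map.
Qed.

Lemma natpoly_add (s t : seq nat) :
  natpoly (add_coefs s t) = natpoly s + natpoly t.
Proof. by apply/polyP=> i; rewrite coefD !coef_natpoly nth_add_coefs natrD. Qed.

Lemma natpoly_scale (a : nat) (s : seq nat) :
  natpoly [seq (a * x)%N | x <- s] = a%:R *: natpoly s.
Proof.
apply/polyP=> i; rewrite coefZ !coef_natpoly.
have [iv|vi] := ltnP i (size s); first by rewrite (nth_map 0%N) // natrM.
by rewrite !nth_default ?size_map ?mulr0.
Qed.

Lemma natpoly_shift (s : seq nat) : natpoly (0%N :: s) = natpoly s * 'X.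
Proof. by apply/polyP=> [[|i]]; rewrite coefMX !coef_natpoly. Qed.

Lemma natpoly_nseq0 (n : nat) : natpoly (nseq n 0%N) = 0.
Proof. by apply/polyP=> i; rewrite coef_natpoly nth_nseq if_same coef0. Qed.

End NatCoefs.

Lemma F3_natP (a : 'F_3) : exists2 n, n \in [:: 0; 1; 2]%N & a = n%:R.
Proof.
exists (a : nat); last by rewrite natr_Zp.
by case: a => [[|[|[|n]]]].
Qed.

Lemma natr_F3_eq0 (n : nat) : (n%:R == 0 :> 'F_3) = (n %% 3 == 0)%N.
Proof. by rewrite -val_eqE /= val_Fp_nat. Qed.

(** Writing m = a + m' X with a constant gives m g = a g + (m' g) X, which is the recursion of
    [multiples]; the bound on the degree drops by one with each coefficient removed. *)
Lemma mem_multiples (g : seq nat) (k : nat) (p : {poly 'F_3}) :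
  p \in map (natpoly 'F_3) (multiples g k) <->
  exists2 m : {poly 'F_3}, (size m <= k)%N & p = m * natpoly 'F_3 g.
Proof.
elim: k p => [|k IHk] p.
  rewrite inE natpoly_nseq0; split=> [/eqP->|[m]].
    by exists 0; rewrite ?size_poly0 ?mul0r.
  by rewrite leqn0 size_poly_eq0 => /eqP-> ->; rewrite mul0r.
split=> [/mapP[v /allpairsP[[a u] /= [_ uM ->]] ->]|[m sm ->]].
  have [m sm um] := (IHk _).1 (map_f (natpoly 'F_3) uM).
  exists (a%:R%:P + m * 'X).
    apply: leq_trans (size_polyD _ _) _; rewrite geq_max.
    rewrite (leq_trans (size_polyC_leq1 _)) //=.
    by apply: leq_trans (size_polyMleq _ _) _; rewrite size_polyX addn2 /= ltnS.
  by rewrite natpoly_add natpoly_scale natpoly_shift um mulrDl mul_polyC mulrAC.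
have [a aI am] := F3_natP m`_0.
have sd : (size (drop_poly 1 m) <= k)%N by rewrite size_drop_poly leq_subLR.
have /mapP[v vM ve] :
    drop_poly 1 m * natpoly 'F_3 g \in map (natpoly 'F_3) (multiples g k).
  by apply/IHk; exists (drop_poly 1 m).
apply/mapP; exists (add_coefs [seq (a * x)%N | x <- g] (0%N :: v)).
  by apply/allpairsP; exists (a, v).
rewrite natpoly_add natpoly_scale natpoly_shift -ve.
rewrite -{1}(poly_take_drop 1 m) mulrDl expr1 [in RHS]mulrAC -mul_polyC -am.
congr (_ * _ + _); apply/polyP=> [[|i]]; by rewrite coef_take_poly coefC.
Qed.

Lemma natpoly_multiplesS (g : seq nat) (k : nat) :
  map (natpoly 'F_3) (multiples g k.+1) =
  [seq a%:R *: natpoly 'F_3 g + p * 'X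
     | a <- [:: 0; 1; 2]%N, p <- map (natpoly 'F_3) (multiples g k)].
Proof.
rewrite -[multiples g k.+1]/(allpairs _ _ _) map_allpairs allpairs_mapr.
apply: eq_allpairs => // a v.
by rewrite natpoly_add natpoly_scale natpoly_shift.
Qed.

(** As g has constant term 1, the constant term of a g + p X is a; then p is recovered by cancelling
    X. *)
Lemma uniq_multiples (g : seq nat) (k : nat) :
  nth 0%N g 0 = 1%N -> uniq (map (natpoly 'F_3) (multiples g k)).
Proof.
move=> g0; elim: k => [|k IHk] //.
rewrite natpoly_multiplesS; apply: allpairs_uniq => //.
move=> x y /allpairsP[[a p] [aI _ ->]] /allpairsP[[b q] [bI _ ->]].
move: aI bI; rewrite /uncurry /fst /snd => aI bI eq_abpq.
have ab : a = b.
  have := congr1 (fun p : {poly 'F_3} => p`_0) eq_abpq.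
  rewrite !coefD !coefZ !coefMX !eqxx !addr0 coef_natpoly g0 !mulr1.
  (* The constant terms agree in F_3 only; a and b are equal as natural numbers because both are
     below 3. *)
  move/(congr1 (@nat_of_ord _)); rewrite !val_Fp_nat //.
  by rewrite !modn_small //; [move: bI|move: aI];
     rewrite !inE => /or3P[] /eqP->.
move: eq_abpq; rewrite ab => /addrI pq; congr (_, _).
by apply: mulIf pq; rewrite polyX_eq0.
Qed.

Lemma map_natpoly (A B : comNzRingType) (f : {rmorphism A -> B}) (v : seq nat) :
  map_poly f (natpoly A v) = natpoly B v.
Proof. by apply/polyP=> i; rewrite coef_map /= !coef_natpoly rmorph_nat. Qed.

(** * Factors of X^13 - 1 in characteristic 3 *)

Section QRFactors.
Variables (A : comNzRingType) (x : A).
Hypothesis A3 : 3%:R = 0 :> A.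

(** The tactic [ring] proves identities with integer coefficients, so an identity modulo 3 is passed
    to it with an explicit multiple of 3 added. *)
Lemma eq_mod3 (a b c : A) : a = b + 3%:R * c -> a = b.
Proof. by rewrite A3 mul0r addr0. Qed.

(* In this and the next two proofs the multiple of 3 is the remainder left by
   the corresponding division over the integers. *)
Lemma qr_factorization :
  x ^+ 13 - 1 =
  (x - 1) * (natpoly A qr_coefs1).[x] * (natpoly A qr_coefs2).[x].
Proof.
rewrite /natpoly !horner_Poly /=.
apply: (@eq_mod3 _ _ (x ^+ 2 + 2%:R * x ^+ 4 - x ^+ 5 + x ^+ 6 - x ^+ 7
                      + x ^+ 8 - 2%:R * x ^+ 9 - x ^+ 11)).
by ring.
Qed.

Lemma qr_coefs1_pow4 :
  (natpoly A qr_coefs1).[x] = 0 -> (natpoly A qr_coefs1).[x ^+ 4] = 0.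
Proof.
set g := (natpoly A qr_coefs1).[x] => gx.
(* The cofactor lists the coefficients modulo 3 of the quotient of g1(X^4) by g1(X), of degree 24 -
   6 = 18. *)
suff -> : (natpoly A qr_coefs1).[x ^+ 4] =
    g * (natpoly A [:: 1; 2; 2; 0; 1; 0; 0; 2; 2; 2; 2; 2; 0; 0; 1; 0; 2; 2;
                       1]%N).[x].
  by rewrite gx mul0r.
apply: (@eq_mod3 _ _ (- (natpoly A
  [:: 0; 1; 2; 2; 2; 2; 3; 2; 2; 3; 3; 4; 4; 4; 3; 3; 2; 2; 3; 2; 2; 2; 2;
      1]%N).[x])).
rewrite /g /natpoly !horner_Poly /=.
by ring.
Qed.

Lemma qr_coefs2_pow4 :
  (natpoly A qr_coefs2).[x] = 0 -> (natpoly A qr_coefs2).[x ^+ 4] = 0.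
Proof.
set g := (natpoly A qr_coefs2).[x] => gx.
suff -> : (natpoly A qr_coefs2).[x ^+ 4] =
    g * (natpoly A [:: 1; 0; 1; 1; 2; 2; 0; 2; 2; 0; 2; 2; 0; 2; 2; 1; 1; 0;
                       1]%N).[x].
  by rewrite gx mul0r.
apply: (@eq_mod3 _ _ (- (natpoly A
  [:: 0; 0; 1; 1; 2; 2; 3; 4; 3; 3; 4; 4; 2; 4; 4; 3; 3; 4; 3; 2; 2; 1;
      1]%N).[x])).
rewrite /g /natpoly !horner_Poly /=.
by ring.
Qed.

End QRFactors.

(** * Identification of the generator polynomial *)

Lemma F3_3 : 3%:R = 0 :> 'F_3.
Proof. exact: val_inj. Qed.

Lemma polyseq_natpoly (A : comNzRingType) (v : seq nat) :
  last 0%N v = 1%N -> natpoly A v = [seq n%:R | n <- v] :> seq A.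
Proof.
move=> v1; apply: (@PolyK _ 1).
case: v v1 => [//|n v] /=; rewrite (last_map (fun n => n%:R)) => ->.
exact: oner_neq0.
Qed.

Lemma natpoly_monic (A : comNzRingType) (v : seq nat) :
  last 0%N v = 1%N -> natpoly A v \is monic.
Proof.
move=> v1; rewrite monicE lead_coefE coef_natpoly polyseq_natpoly // size_map.
by rewrite nth_last v1.
Qed.

Lemma size_natpoly (A : comNzRingType) (v : seq nat) :
  last 0%N v = 1%N -> size (natpoly A v) = size v.
Proof. by move=> v1; rewrite polyseq_natpoly // size_map. Qed.

(** Evaluating at the indeterminate turns identities between values in a commutative ring into
    polynomial identities. *)
Lemma horner_natpolyX (A : comNzRingType) (v : seq nat) :
  (natpoly {poly A} v).['X] = natpoly A v.
Proof. by rewrite -(map_natpoly polyC) -[LHS]/(_ \Po 'X) comp_polyXr. Qed.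

(** The squares form a cyclic group of order 6 generated by 4, so exponents below 6 suffice; the
    twelve values of s are checked by evaluation. *)
Lemma nonzero_squares13_pow4 (r : 'F_13) :
  r \in nonzero_squares 13 -> exists k, r = (4 ^ k %% 13)%N :> nat.
Proof.
case/imsetP=> s; rewrite !inE => s0 ->.
have s13 : (s < 13)%N by apply: leq_trans (ltn_ord s) _.
have : (s : nat) \in iota 1 12.
  by rewrite mem_iota s13 andbT lt0n; move: s0; rewrite -val_eqE.
have /allP H : all (fun n => has (fun k => n ^ 2 %% 13 == 4 ^ k %% 13)
                                 (iota 0 6))%N (iota 1 12) by [].
move/H/hasP=> [k _ /eqP sk]; exists k; rewrite -sk.
by rewrite -[s in LHS]natr_Zp -natrX val_Fp_nat.
Qed.

(** The squares of 1, ..., 6 are distinct modulo 13. This bounds the degree of [qr_poly] from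
    below. *)
Lemma card_nonzero_squares13 : (6 <= #|nonzero_squares 13|)%N.
Proof.
pose s : seq 'F_13 := [seq n%:R ^+ 2 | n <- iota 1 6].
have us : uniq s by vm_compute.
rewrite -[6%N]/(size s) cardE; apply: uniq_leq_size => // _ /mapP[n nI ->].
rewrite mem_enum; apply: imset_f; rewrite !inE -val_eqE /= val_Fp_nat //.
move: nI; rewrite mem_iota => /andP[n0 n7].
by rewrite modn_small -?lt0n // (leq_trans n7).
Qed.

Section QRGenerator.
Variables (L : fieldType) (iota : {rmorphism 'F_3 -> L}) (alpha : L).
Hypothesis halpha : 13.-primitive_root alpha.

(** Closure of the roots under x -> x^4 makes every alpha^r with r a square a root of v. Hence
    [qr_poly], of degree at least 6, divides the monic v of degree 6, and being monic it equals v.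
    Injectivity of [iota] brings this back to F_3. *)
Lemma qr_genpoly_of_root (v : seq nat) :
    last 0%N v = 1%N -> size v = 7%N ->
    (forall x : L, (natpoly L v).[x] = 0 -> (natpoly L v).[x ^+ 4] = 0) ->
    (natpoly L v).[alpha] = 0 ->
  qr_genpoly iota 13 alpha = natpoly 'F_3 v.
Proof.
move=> v1 sv v4 va; apply: (map_inj_poly (fmorph_inj iota) (rmorph0 iota)).
rewrite [LHS]map_qr_genpoly //; last first.
  (* 3 is a square modulo 13, since 4^2 = 16. *)
  apply/imsetP; exists 4%:R; first by rewrite !inE -val_eqE.
  by rewrite card_Fp //; apply: val_inj.
have vk k : (natpoly L v).[alpha ^+ (4 ^ k)] = 0.
  by elim: k => [|k IHk]; rewrite ?expr1 // expnSr exprM v4.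
pose rs := [seq alpha ^+ r | r : 'F_13 <- enum (nonzero_squares 13)].
have qrE : qr_poly 13 alpha = \prod_(z <- rs) ('X - z%:P).
  by rewrite big_map big_enum.
have urs : uniq rs.
  rewrite map_inj_uniq ?enum_uniq // => r s /eqP.
  rewrite (eq_prim_root_expr halpha) !modn_small ?ltn_ord // => /eqP rs_eq.
  exact: val_inj.
have dv : qr_poly 13 alpha %| natpoly L v.
  rewrite qrE; apply: uniq_roots_dvdp; last by rewrite uniq_rootsE.
  apply/allP=> _ /mapP[r + ->].
  rewrite mem_enum => /nonzero_squares13_pow4[k ->].
  by rewrite /root (prim_expr_mod halpha) vk.
have vn0 : natpoly L v != 0 by apply/monic_neq0/natpoly_monic.
have := dvdp_leq vn0 dv; rewrite size_natpoly // sv => s7.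
apply/eqP; rewrite (map_natpoly iota) -eqp_monic ?natpoly_monic //; last first.
  by rewrite qrE monic_prod_XsubC.
rewrite -dvdp_size_eqp // eqn_leq size_natpoly // sv s7 /=.
by rewrite qrE size_prod_XsubC size_map -cardE ltnS card_nonzero_squares13.
Qed.

(** As alpha^13 = 1 and alpha is not 1, one of the two factors of degree 6 vanishes at alpha. *)
Lemma qr_genpoly_cases :
  qr_genpoly iota 13 alpha = natpoly 'F_3 qr_coefs1 \/
  qr_genpoly iota 13 alpha = natpoly 'F_3 qr_coefs2.
Proof.
have L3 : 3%:R = 0 :> L by rewrite -(rmorph_nat iota) F3_3 rmorph0.
have a1 : alpha - 1 != 0.
  rewrite subr_eq0 -(prim_order_dvd halpha 1) //.
have /eqP := qr_factorization alpha L3.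
rewrite (prim_expr_order halpha) subrr eq_sym !mulf_eq0 (negPf a1) /=.
case/orP=> /eqP ga; [left|right]; apply: qr_genpoly_of_root => // x.
  exact: qr_coefs1_pow4.
exact: qr_coefs2_pow4.
Qed.

End QRGenerator.

Lemma qr_coefs1_dvd : natpoly 'F_3 qr_coefs1 %| 'X^13 - 1.
Proof.
rewrite (@qr_factorization {poly 'F_3}) ?horner_natpolyX.
  by rewrite mulrAC dvdp_mull.
by rewrite -(rmorph_nat polyC) F3_3.
Qed.

Lemma qr_coefs2_dvd : natpoly 'F_3 qr_coefs2 %| 'X^13 - 1.
Proof.
rewrite (@qr_factorization {poly 'F_3}) ?horner_natpolyX.
  exact: dvdp_mull.
by rewrite -(rmorph_nat polyC) F3_3.
Qed.

(** * The extended code as a list without repetition *)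

Lemma extend_word_inj (F : finFieldType) (n : nat) :
  injective (@extend_word F n).
Proof.
move=> c d /rowP cd; apply/rowP=> i.
by have := cd (lift ord_max i); rewrite !mxE liftK.
Qed.

Definition nat_word (v : seq nat) : 'rV['F_3]_14 :=
  @extend_word 'F_3 13 (poly_rV (natpoly 'F_3 v)).

Section CodeEnumeration.
Variables (L : fieldType) (iota : {rmorphism 'F_3 -> L}) (alpha : L).
Variable v : seq nat.
Hypothesis genE : qr_genpoly iota 13 alpha = natpoly 'F_3 v.
Hypotheses (v_first : nth 0%N v 0 = 1%N) (v_last : last 0%N v = 1%N).
Hypotheses (size_v : size v = 7%N) (v_dvd : natpoly 'F_3 v %| 'X^13 - 1).

(** Since v divides X^13 - 1, reduction modulo X^13 - 1 preserves divisibility by v. A remainder has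
    degree at most 12 and v has degree 6, so the cofactor has degree at most 6. *)
Lemma qr_codeP (c : 'rV['F_3]_13) :
  c \in qr_code iota 13 alpha <->
  exists2 m : {poly 'F_3}, (size m <= 7)%N & c = poly_rV (m * natpoly 'F_3 v).
Proof.
have vn0 : natpoly 'F_3 v != 0 by apply/monic_neq0/natpoly_monic.
(* The quotient ring is built on [mk_monic], which returns its argument only when that is monic and
   nonconstant. *)
have mon : mk_monic ('X^13 - 1 : {poly 'F_3}) = 'X^13 - 1.
  by rewrite /mk_monic size_XnsubC // monicXnsubC.
split=> [/imsetP[a _ ->]|[m sm ->]].
  rewrite poly_of_qpolyM /= genE; move: (qpoly.polyn a) => b; rewrite mon.
  set r := Pdiv.Ring.rmodp _ _.
  have : natpoly 'F_3 v %| r.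
    rewrite /r -!Pdiv.IdomainMonic.modpE ?monicXnsubC //.
    by rewrite -dvdp_mod ?dvdp_mull -?dvdp_mod.
  case/dvdpP=> m rm; exists m; last by rewrite rm.
  have : (size r < 14)%N.
    rewrite -(@size_XnsubC 'F_3 13 1) //.
    by rewrite Pdiv.Ring.ltn_rmodpN0 // monic_neq0 // monicXnsubC.
  have [->|m0] := eqVneq m 0; first by rewrite size_poly0.
  rewrite rm size_mul // size_natpoly // size_v addnS /= ltnS => ms.
  by rewrite -(leq_add2r 6).
apply/imsetP; exists (in_qpoly ('X^13 - 1) m) => //.
rewrite -in_qpolyM genE in_qpoly_small // mon size_XnsubC // ltnS.
apply: leq_trans (size_polyMleq _ _) _; rewrite size_natpoly // size_v addnS /=.
by rewrite -[13%N]/(7 + 6)%N leq_add2r.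
Qed.

Lemma size_natpoly_multiples (u : seq nat) :
  u \in multiples v 7 -> (size (natpoly 'F_3 u) <= 13)%N.
Proof.
move=> /size_multiples; rewrite size_v => su.
by apply: leq_trans (size_Poly _) _; rewrite size_map su.
Qed.

Lemma uniq_nat_words : uniq (map nat_word (multiples v 7)).
Proof.
rewrite /nat_word (map_comp (@extend_word 'F_3 13)).
rewrite (map_inj_uniq (@extend_word_inj _ _)).
rewrite (map_comp (@poly_rV 'F_3 13)) map_inj_in_uniq ?uniq_multiples //.
move=> _ _ /mapP[p pM ->] /mapP[q qM ->].
by move=> /(congr1 rVpoly); rewrite !poly_rV_K // size_natpoly_multiples.
Qed.

Lemma ext_qr_codeE :
  ext_qr_code iota 13 alpha =i map nat_word (multiples v 7).
Proof.
move=> c; apply/imsetP/mapP=> [[d /qr_codeP[m sm ->] ->]|[u uM ->]].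
  have /mapP[u uM mu] :
      m * natpoly 'F_3 v \in map (natpoly 'F_3) (multiples v 7).
    by apply/mem_multiples; exists m.
  by exists u; rewrite // /nat_word -mu.
exists (poly_rV (natpoly 'F_3 u)) => //; apply/qr_codeP.
have /mem_multiples[m sm um] := map_f (natpoly 'F_3) uM.
by exists m; rewrite // -um.
Qed.

Lemma sum_ext_qr_code (V : nmodType) (P : pred 'rV['F_3]_14)
    (G : 'rV['F_3]_14 -> V) :
  \sum_(c in ext_qr_code iota 13 alpha | P c) G c =
  \sum_(u <- multiples v 7 | P (nat_word u)) G (nat_word u).
Proof.
rewrite -(big_map nat_word P G) big_mkcondr [RHS]big_mkcond.
rewrite big_uniq ?uniq_nat_words //.
by apply: eq_bigl => c; rewrite ext_qr_codeE.
Qed.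

End CodeEnumeration.

(** * Supports and weights read off the bit patterns *)

Lemma nat_word_neq0 (u : seq nat) (i : 'I_14) :
  size u = 13%N -> (nat_word u 0 i != 0) = nth false (nonzero_pattern u) i.
Proof.
move=> su; rewrite (nth_map 0%N) ?size_rcons ?su // nth_rcons su mxE.
case: unliftP => [j|] ->.
  by rewrite lift_max ltn_ord /= mxE coef_natpoly natr_F3_eq0.
rewrite /= oppr_eq0 -natr_F3_eq0; congr (_ != 0).
rewrite sumnE (big_nth 0%N) su big_mkord natr_sum.
by apply: eq_bigr => j _; rewrite mxE coef_natpoly.
Qed.

Lemma card_bitset (n : nat) (b : bitseq) :
  size b = n -> #|[set i : 'I_n | nth false b i]| = count id b.
Proof.
move=> <-; rewrite cardsE -sum1_card -sum1_count (big_nth false) big_mkord.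
exact: eq_bigl.
Qed.

Lemma supp_nat_word (u : seq nat) :
  size u = 13%N ->
  supp (nat_word u) = [set i : 'I_14 | nth false (nonzero_pattern u) i].
Proof. by move=> su; apply/setP=> i; rewrite !inE nat_word_neq0. Qed.

Lemma wt_nat_word (u : seq nat) :
  size u = 13%N -> wt (nat_word u) = count id (nonzero_pattern u).
Proof.
move=> su; rewrite /wt supp_nat_word // card_bitset //.
by rewrite size_map size_rcons su.
Qed.

(** The enumeration of a set of ordinals is increasing; this matches triples with the increasing
    indices of the computation. *)
Lemma card3_ordP (n : nat) (z : {set 'I_n}) :
  #|z| = 3%N ->
  exists i j k : 'I_n, [/\ (i < j)%N, (j < k)%N & z = [set i; j; k]].
Proof.
move=> z3; have : sorted (fun i j : 'I_n => i < j)%N (enum z).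
  rewrite /enum_mem sorted_filter //; first by move=> ? ? ?; apply: ltn_trans.
  by have := iota_ltn_sorted 0 n; rewrite -val_enum_ord sorted_map enumT.
have : size (enum z) = 3%N by rewrite -cardE.
have ez i : (i \in z) = (i \in enum z) by rewrite mem_enum.
case: (enum z) ez => [|i [|j [|k [|//]]]] // ez _ /= /and3P[ij jk _].
exists i, j, k; split=> //; apply/setP=> l.
by rewrite ez !inE orbA.
Qed.

(** * Harmonic functions and exchange of summation *)

Section Harmonic.
Variables (R : realType) (n : nat).

Lemma gammaE (f : {ffun {set 'I_n} -> R^o}) (y : {set 'I_n}) :
  gamma f y =
  \sum_(z : {set 'I_n} | (#|y|.+1 == #|z|) && (y \subset z)) f z.
Proof.
rewrite /gamma sum_ffunE big_mkcond [in RHS]big_mkcond /=.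
apply: eq_bigr => z _; rewrite ffunE sum_ffunE.
case: ifP => yz.
  rewrite (bigD1 y) //= ffunE eqxx big1 ?addr0; first exact: mulr1.
  by move=> u /andP[_ uy]; rewrite ffunE eq_sym (negPf uy).
rewrite big1 ?scaler0 // => u uz; rewrite ffunE; case: eqP => // yu.
by rewrite yu uz in yz.
Qed.

(** Double counting: a k-set has k subsets of size k - 1, so the values of [gamma f] add up to k
    times the sum of f. The former are zero, and k is invertible in R. *)
Lemma Harm_sum0 (k : nat) (f : {ffun {set 'I_n} -> R^o}) :
  (0 < k)%N -> Harm k f -> \sum_(z : {set 'I_n} | #|z| == k) f z = 0.
Proof.
move=> k0 [fk gf0].
have : \sum_(y : {set 'I_n}) gamma f y = 0.
  by apply: big1 => y _; rewrite gf0 ffunE.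
under eq_bigr do rewrite gammaE.
rewrite (exchange_big_dep predT) //=.
rewrite (bigID (fun z : {set 'I_n} => #|z| == k)) /=.
rewrite [X in _ + X]big1 => [|z zk]; last by rewrite fk // sumr_const mul0rn.
rewrite addr0 (eq_bigr (fun z => f z *+ k)) => [|z /eqP zk].
  rewrite sumrMnl => /eqP; rewrite mulrn_eq0 => /orP[/eqP k00|/eqP //].
  by rewrite k00 in k0.
rewrite sumr_const; congr (_ *+ _).
(* Here k is rewritten as the binomial coefficient of k over k - 1, which counts the subsets of z of
   size k - 1. *)
rewrite -[RHS]bin1 -[in RHS](@bin_sub k 1) // -[X in 'C(X, _)]zk -cards_draws.
rewrite -cardsE; apply: eq_card => y; rewrite !inE zk andbC.
by rewrite -(eqn_add2r 1) subnK // addn1.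
Qed.

End Harmonic.

Section WeightEnumerator.
Variables (R : realType) (F : finFieldType) (n k : nat).

Definition wt_monomial (w : nat) : {mpoly R[2]} :=
  'X_ord0 ^+ (n - w) * 'X_ord_max ^+ w.

Lemma harm_wt_enum_exchange (C : {set 'rV[F]_n})
    (f : {ffun {set 'I_n} -> R^o}) :
  harm_wt_enum C k f =
  \sum_(z : {set 'I_n} | #|z| == k)
    (f z : R) *: \sum_(c in C | z \subset supp c) wt_monomial (wt c).
Proof.
rewrite /harm_wt_enum; under eq_bigr do rewrite /tilde scaler_suml.
rewrite (exchange_big_dep (fun z : {set 'I_n} => #|z| == k)) /=;
  last by move=> c z _ /andP[].
by apply: eq_bigr => z zk; rewrite scaler_sumr; apply: eq_bigl => c; rewrite zk.
Qed.

End WeightEnumerator.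

(** * The two local weight enumerators and the conclusion *)

Definition profile_enum (R : realType) (p : seq nat) : {mpoly R[2]} :=
  \sum_(w < 15) (nth 0%N p w)%:R *: wt_monomial R 14 w.

Lemma two_profiles_enum (R : realType) (v : seq nat) (z : {set 'I_14}) :
    size v = 7%N -> two_profiles (map nonzero_pattern (multiples v 7)) ->
    #|z| = 3%N ->
  exists2 p, p \in [:: profile_a; profile_b] &
    \sum_(u <- multiples v 7 | z \subset supp (nat_word u))
      wt_monomial R 14 (wt (nat_word u)) = profile_enum R p.
Proof.
move=> sv tp /card3_ordP[i [j [k [ij jk ->]]]].
have [p pP pE] := two_profilesP tp ij jk (ltn_ord k).
exists p => //; rewrite /profile_enum.
under [RHS]eq_bigr => w _.
  rewrite -pE // count_map -sum1_count natr_sum scaler_suml.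
  under eq_bigr do rewrite scale1r.
  over.
rewrite /= [RHS](exchange_big_dep predT) //= big_mkcond !big_seq.
apply: eq_bigr => u uM.
have su : size u = 13%N by rewrite (size_multiples _ uM) ?sv.
rewrite supp_nat_word // wt_nat_word // !subUset !sub1set !inE.
set b := nonzero_pattern u.
have b15 : (count id b < 15)%N.
  by rewrite ltnS (leq_trans (count_size _ _)) // size_map size_rcons su.
case: (nth false b i); last by rewrite big_pred0.
case: (nth false b j); last by rewrite big_pred0.
case: (nth false b k); last by rewrite big_pred0.
(* A word whose support contains the triple is counted for exactly one w, its own weight. *)
by rewrite (big_pred1 (Ordinal b15)) // => w; rewrite /= eq_sym -val_eqE.
Qed.

(** The entries of A - B at weights 6, 7, 8, 9, 11 are 4, -6, -4, 8, -2; multiplying by -78 gives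
    the stated coefficients. *)
Lemma profile_enumB (R : realType) :
  let x : {mpoly R[2]} := 'X_ord0 in
  let y : {mpoly R[2]} := 'X_ord_max in
  - 312%:R * x ^+ 8 * y ^+ 6 + 468%:R * x ^+ 7 * y ^+ 7
  + 312%:R * x ^+ 6 * y ^+ 8 - 624%:R * x ^+ 5 * y ^+ 9
  + 156%:R * x ^+ 3 * y ^+ 11 =
  - 78%:R *: (profile_enum R profile_a - profile_enum R profile_b).
Proof.
move=> x y; rewrite /profile_enum !big_ord_recl !big_ord0 /= /wt_monomial.
rewrite -/x -/y /= !scaler_nat scaleNr scaler_nat.
by ring.
Qed.

(** Each triple contributes B plus either 0 or A - B. Weighted by f, the constant part B cancels
    because f sums to zero over the triples. *)
Lemma harm_wt_enum_qr14 (R : realType) (L : fieldType)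
    (iota : {rmorphism 'F_3 -> L}) (alpha : L) (v : seq nat)
    (f : {ffun {set 'I_14} -> R^o}) :
    qr_genpoly iota 13 alpha = natpoly 'F_3 v ->
    nth 0%N v 0 = 1%N -> last 0%N v = 1%N -> size v = 7%N ->
    natpoly 'F_3 v %| 'X^13 - 1 ->
    two_profiles (map nonzero_pattern (multiples v 7)) -> Harm 3 f ->
  exists c : R, harm_wt_enum (ext_qr_code iota 13 alpha) 3 f =
    c *: (profile_enum R profile_a - profile_enum R profile_b).
Proof.
move=> genE v0 vl sv vd tp hf.
pose E (z : {set 'I_14}) : {mpoly R[2]} :=
  \sum_(u <- multiples v 7 | z \subset supp (nat_word u))
    wt_monomial R 14 (wt (nat_word u)).
have EP (z : {set 'I_14}) : #|z| == 3%N ->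
    E z = profile_enum R profile_b +
      (E z == profile_enum R profile_a)%:R *:
        (profile_enum R profile_a - profile_enum R profile_b).
  move=> /eqP /(two_profiles_enum R sv tp)[p + Ep]; rewrite /E Ep !inE.
  case/orP=> /eqP->; first by rewrite eqxx scale1r addrC subrK.
  (* If B happened to equal A, the indicator would be 1, but A - B would vanish. *)
  case: eqP => [->|_]; last by rewrite scale0r addr0.
  by rewrite subrr scaler0 addr0.
exists (\sum_(z : {set 'I_14} | #|z| == 3%N)
          f z * (E z == profile_enum R profile_a)%:R).
rewrite harm_wt_enum_exchange.
under eq_bigr => z z3.
  rewrite (sum_ext_qr_code genE) // -/(E z) EP // scalerDr scalerA.
  over.
rewrite big_split /= -!scaler_suml Harm_sum0 // scale0r add0r.
by [].
Qed.

Theorem theorem3p2 (R : realType) (L : fieldType)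
    (iota : {rmorphism 'F_3 -> L}) (alpha : L)
    (halpha : 13.-primitive_root alpha)
    (C : {set 'rV['F_3]_14}) (hC : C = ext_qr_code iota 13 alpha)
    (f : {ffun {set 'I_14} -> R^o}) (hf : Harm 3 f)
    (hinv : forall s : 'S_14, s \in code_aut C -> perm_fun s f = f) :
  let x : {mpoly R[2]} := 'X_ord0 in
  let y : {mpoly R[2]} := 'X_ord_max in
  exists c_f : R,
    harm_wt_enum C 3 f =
      c_f *: (- 312%:R * x ^+ 8 * y ^+ 6 + 468%:R * x ^+ 7 * y ^+ 7
              + 312%:R * x ^+ 6 * y ^+ 8 - 624%:R * x ^+ 5 * y ^+ 9
              + 156%:R * x ^+ 3 * y ^+ 11).
Proof.
move=> x y; rewrite hC.
suff [c ->] : exists c : R, harm_wt_enum (ext_qr_code iota 13 alpha) 3 f =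
    c *: (profile_enum R profile_a - profile_enum R profile_b).
  (* The stated polynomial is -78 (A - B), so the constant is divided by -78. *)
  exists (c / - 78%:R); rewrite profile_enumB scalerA divfK //.
  by rewrite oppr_eq0 pnatr_eq0.
have [gE|gE] := qr_genpoly_cases iota halpha.
  exact: (harm_wt_enum_qr14 gE _ _ _ qr_coefs1_dvd two_profiles_qr1).
exact: (harm_wt_enum_qr14 gE _ _ _ qr_coefs2_dvd two_profiles_qr2).
Qed.
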